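(* Let $G$ be an amenable group, $A$ a finite set, and $\mathcal{F} = (F_j)_{j \in J}$ a Følner net for $G$. Let $X \subset A^G$ be a strongly irreducible subshift containing at least two distinct configurations. Then $\operatorname{ent}_{\mathcal{F}}(X) > 0$.
   Context: $A^G$ is the set of all maps $x \colon G \to A$ (configurations) with the product of the discrete topologies; $G$ acts by $(gx)(h) = x(g^{-1}h)$. A subshift is a closed $G$-invariant subset. For $\Omega \subset G$, $x|_\Omega$ is the restriction and $X_\Omega = \{x|_\Omega : x \in X\} \subset A^\Omega$. For $\Omega,\Delta \subset G$ put $\Omega^{+\Delta} = \{g \in G : g\Delta \cap \Omega \neq \varnothing\} = \Omega\Delta^{-1}$. A subshift $X$ is strongly irreducible if there is a finite $\Delta \subset G$ such that for all finite $\Omega_1,\Omega_2 \subset G$ with $\Omega_1^{+\Delta} \cap \Omega_2 = \varnothing$ and all $x_1,x_2 \in X$ there is $x \in X$ with $x|_{\Omega_1} = x_1|_{\Omega_1}$ and $x|_{\Omega_2} = x_2|_{\Omega_2}$. A Følner net for $G$ is a family $\mathcal{F} = (F_j)_{j\in J}$ of nonempty finite subsets of $G$ indexed by a directed set $J$ such that $\lim_j |F_j^{+E}\setminus F_j|/|F_j| = 0$ for every finite $E \subset G$; $G$ is amenable if it admits one. The entropy of a subset $X \subset A^G$ is $\operatorname{ent}_{\mathcal{F}}(X) = \limsup_j \frac{\log |X_{F_j}|}{|F_j|}$. *)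

(* Defs.v *)
From mathcomp Require Export all_boot all_order all_algebra.
From mathcomp Require Export finmap.
From mathcomp Require Export all_classical all_reals all_analysis.

Set Implicit Arguments.
Unset Strict Implicit.
Unset Printing Implicit Defensive.

Import Order.TTheory GRing.Theory Num.Theory.
Import numFieldNormedType.Exports.

Local Open Scope classical_set_scope.
Local Open Scope ring_scope.

Section Configurations.
Variables (G : groupType) (A : finType).
Implicit Types (X : set (G -> A)) (x : G -> A) (W D : {fset G}).

Definition translate (g : G) x : G -> A := fun h => x (g^-1 * h)%g.

(* The cast selects the product of the discrete topologies on A^G. *)
Definition subshift X : Prop :=
  closed (X : set {ptws G -> discrete_topology A}) /\
  forall (g : G) x, X x -> X (translate g x).

Definition restriction W x : {ffun W -> A} := [ffun h : W => x (val h)].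

Definition patterns X W : set {ffun W -> A} := restriction W @` X.

(* The set Omega^{+Delta}, as Omega Delta^-1. *)
Definition thickening W D : {fset G} :=
  [fset (g * d^-1)%g | g in W, d in D]%fset.

Lemma thickeningP W D (g : G) :
  reflect (exists2 d, d \in D & (g * d)%g \in W) (g \in thickening W D).
Proof.
apply: (iffP (imfset2P _ _ _ _ _)) => [[h hW [d dD ->]]|[d dD gdW]].
  by exists d => //; rewrite mulgVK.
by exists (g * d)%g => //; exists d => //; rewrite mulgK.
Qed.

Definition strongly_irreducible X : Prop :=
  exists D : {fset G}, forall W1 W2 : {fset G},
    (thickening W1 D `&` W2)%fset = fset0 ->
    forall x1 x2, X x1 -> X x2 ->
    exists x, [/\ X x, restriction W1 x = restriction W1 x1
                & restriction W2 x = restriction W2 x2].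

End Configurations.
Arguments patterns {G A} X W _.

Section Nets.
Context {d : Order.disp_t}.
Variable J : preorderType d.

Definition directed : Prop :=
  [set: J] !=set0 /\ forall i j : J, exists2 k : J, (i <= k)%O & (j <= k)%O.

(* Convergence along this filter is convergence of nets indexed by J. *)
Definition tails : set_system J :=
  filter_from [set: J] (fun i => [set j | (i <= j)%O]).

Lemma tails_filter : directed -> ProperFilter tails.
Proof.
move=> [J0 Jdir]; apply: filter_from_proper; last first.
  by move=> i _; exists i => /=.
apply: filter_from_filter => // i j _ _.
have [k ik jk] := Jdir i j; exists k => // l /= kl.
by split; [exact: le_trans ik kl | exact: le_trans jk kl].
Qed.

(* limf_esup asks for a filteredType on the index type; the choice made here,
   the discrete topology, plays no role in its value. *)
Definition net_limsup (R : realType) (u : J -> \bar R) : \bar R :=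
  @limf_esup J (discrete_topology J) R u tails.

Lemma net_limsupE (R : realType) (u : J -> \bar R) :
  net_limsup u =
  ereal_inf (range (fun i => ereal_sup (u @` [set j | (i <= j)%O]))).
Proof.
rewrite /net_limsup limf_esupE; apply/eqP; rewrite eq_le; apply/andP; split.
  apply: ereal_inf_le_tmp => _ [i _ <-] /=.
  by exists [set j | (i <= j)%O] => //; exists i.
apply: le_ereal_inf_tmp => _ [V [i _ iV] <-].
apply: ge_ereal_inf; exists (ereal_sup (u @` [set j | (i <= j)%O])).
  by exists i.
by apply: ereal_sup_le => _ [j ij <-]; exists j => //; exact: iV.
Qed.

End Nets.
Arguments tails {d} J _.

Section Amenability.
Variables (R : realType) (G : groupType).

Definition folner_net (d : Order.disp_t) (J : preorderType d)
    (F : J -> {fset G}) : Prop :=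
  [/\ directed J,
      forall j, F j != fset0
    & forall E : {fset G},
        (#|` (thickening (F j) E `\` F j)%fset|%:R / #|` F j|%:R : R)
          @[j --> tails J] --> (0 : R)].

Definition amenable : Prop :=
  exists (d : Order.disp_t) (J : preorderType d) (F : J -> {fset G}),
    folner_net F.

Definition entropy (A : finType) (d : Order.disp_t) (J : preorderType d)
    (F : J -> {fset G}) (X : set (G -> A)) : \bar R :=
  net_limsup
    (fun j => (ln #|` fset_set (patterns X (F j))|%:R / #|` F j|%:R)%:E).

End Amenability.

(* Main.v *)
(* By shift invariance there are symbols a <> b each of which is taken by some
   configuration of X at any prescribed site. Strong irreducibility, applied to
   one site at a time, then realizes every {a, b}-pattern on any suitably
   separated set of sites, and greedy selection extracts from a finite set W
   such a set S with |W| <= |S| (|D| + 1). Hence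
   log |X_W| / |W| >= log 2 / (|D| + 1) for every nonempty finite W. *)
Require Import Defs.
Import Order.TTheory GRing.Theory Num.Theory.
Import numFieldNormedType.Exports.

Local Open Scope classical_set_scope.
Local Open Scope ring_scope.

Set Implicit Arguments.
Unset Strict Implicit.

Lemma restriction_eqP (G : groupType) (A : finType) (W : {fset G})
    (x y : G -> A) :
  restriction W x = restriction W y <-> {in W, x =1 y}.
Proof.
split=> [/ffunP xy g gW|xy].
  by have := xy [` gW]%fset; rewrite !ffunE.
by apply/ffunP => g; rewrite !ffunE; exact: xy (valP g).
Qed.

(** Translation by [h * g^-1] carries the symbol at [g] to [h]. *)
Lemma subshift_value (G : groupType) (A : finType) (X : set (G -> A))
    (x : G -> A) (g h : G) :
  subshift X -> X x -> exists2 y, X y & y h = x g.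
Proof.
move=> [_ Xinv] Xx; exists (translate (h * g^-1)%g x); first exact: Xinv.
by rewrite /translate invgM invgK mulgVK.
Qed.

(** [T] marks the sites that carry [a]. It is not confined to [S], so the same [T] serves when [S]
    grows by one site. *)
Definition free_at (G : groupType) (A : finType) (X : set (G -> A)) (a b : A)
    (S : {fset G}) : Prop :=
  forall T : {fset G}, exists2 x, X x &
    {in S, forall g, x g = if g \in T then a else b}.

(** Since [a] and [b] differ, distinct subsets of [S] yield distinct patterns on [W]. *)
Lemma free_at_card (G : groupType) (A : finType) (X : set (G -> A)) (a b : A)
    (S W : {fset G}) :
  a != b -> (S `<=` W)%fset -> free_at X a b S ->
  (2 ^ #|` S| <= #|` fset_set (patterns X W)|)%N.
Proof.
move=> ab /fsubsetP SW Sfree.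
pose x T := sval (cid2 (Sfree T)).
have Xx T : X (x T) by rewrite /x; case: cid2.
have xE T : {in S, forall g, x T g = if g \in T then a else b}.
  by rewrite /x; case: cid2.
have <- : #|` [fset restriction W (x T) | T in fpowerset S]%fset| = (2 ^ #|` S|)%N.
  rewrite -card_fpowerset; apply: card_in_imfset.
  move=> T U; rewrite !fpowersetE => TS US /restriction_eqP eqTU.
  apply/fsetP => g; case gS : (g \in S); last first.
    by rewrite (contraFF (fsubsetP TS g) gS) (contraFF (fsubsetP US g) gS).
  have := eqTU g (SW g gS); rewrite !xE //.
  by case: ifP => _; case: ifP => _ // e; rewrite e eqxx in ab.
apply: fsubset_leq_card; apply/fsubsetP => _ /imfsetP[T _ ->].
by rewrite in_fset_set ?inE; [exists (x T) | exact: finite_finset].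
Qed.

(** Induction on the size of [W]: keep a site [s], discard the at most [#|D| + 1] sites that could
    interfere with it, and recurse on the rest. *)
Lemma free_at_greedy (G : groupType) (A : finType) (X : set (G -> A)) (a b : A)
    (D : {fset G}) :
  (forall W1 W2 : {fset G}, (thickening W1 D `&` W2)%fset = fset0 ->
    forall x1 x2, X x1 -> X x2 ->
    exists x, [/\ X x, restriction W1 x = restriction W1 x1
                & restriction W2 x = restriction W2 x2]) ->
  (forall g, exists2 x, X x & x g = a) ->
  (forall g, exists2 x, X x & x g = b) ->
  forall W : {fset G}, exists S : {fset G},
    [/\ (S `<=` W)%fset, free_at X a b S & (#|` W| <= #|` S| * #|` D|.+1)%N].
Proof.
move=> irr Xa Xb W.
have [n] := ubnP #|` W|; elim: n W => // n IH W /ltnSE Wn.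
have [->|[s sW]] := fset_0Vmem W.
  exists fset0; split; rewrite ?cardfs0 //.
  by move=> T; have [x Xx _] := Xa 1%g; exists x => // g; rewrite inE.
(* Avoiding the sites [s * d] keeps [s] out of [thickening S D]; including [s] itself makes [W]
   shrink strictly even if [D] lacks the identity. *)
pose B := (s |` [fset (s * d)%g | d in D])%fset.
have sB : s \in B by rewrite !inE eqxx.
have [|S [SW Sfree Scard]] := IH (W `\` B)%fset.
  apply: leq_trans Wn; apply: fproper_ltn_card; rewrite fproperE fsubsetDl /=.
  by apply/fsubsetPn; exists s; rewrite // inE sB.
have sS : s \notin S.
  by apply/negP => /(fsubsetP SW); rewrite inE sB.
exists (s |` S)%fset; split.
- by rewrite fsubUset fsub1set sW (fsubset_trans SW) ?fsubsetDl.
- move=> T; have [x1 Xx1 x1E] := Sfree T.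
  have [x2 Xx2 x2E] : exists2 x, X x & x s = if s \in T then a else b.
    by case: ifP.
  (* Irreducibility glues [x1] on [S] to [x2] at the single site [s]. *)
  have [|x [Xx /restriction_eqP xS /restriction_eqP xs]] :=
      irr S [fset s]%fset _ x1 x2 Xx1 Xx2.
    apply/eqP; rewrite -fsubset0; apply/fsubsetP => g.
    rewrite !inE => /andP[/thickeningP[e eD geS] /eqP gs]; subst g.
    have := fsubsetP SW _ geS; rewrite !inE => /andP[+ _].
    by rewrite negb_or => /andP[_ /imfsetP[]]; exists e.
  exists x => // g; rewrite !inE => /predU1P[->|gS].
    by rewrite xs ?inE.
  by rewrite xS // x1E.
- rewrite cardfsU1 sS mulSn -(cardfsID B W) leq_add //.
  apply: leq_trans (fsubset_leq_card (fsubsetIr _ _)) _.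
  rewrite /B cardfsU1 -add1n leq_add ?leq_b1 //.
  exact: leq_imfset_card.
Qed.

Unset Implicit Arguments.
Set Strict Implicit.

Theorem proposition4p5 (R : realType) (G : groupType) (A : finType)
    (d : Order.disp_t) (J : preorderType d) (F : J -> {fset G})
    (X : set (G -> A)) :
  amenable R G ->
  folner_net R F ->
  subshift X ->
  strongly_irreducible X ->
  (exists x y : G -> A, [/\ X x, X y & x <> y]) ->
  (0 < entropy R F X)%E.
Proof.
move=> _ [_ F0 _] Xsub [D irr] [x [y [Xx Xy xy]]].
have [g /eqP xyg] : exists g, x g <> y g.
  by apply: contrapT => /forallNP xyE; apply: xy; apply/funext => g;
    exact: contrapT.
(* The two symbols are [x g] and [y g], transported to every site [h]. *)
have greedy := free_at_greedy irr
  (fun h => subshift_value g h Xsub Xx)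
  (fun h => subshift_value g h Xsub Xy).
pose c : R := ln 2 / #|` D|.+1%:R.
have c0 : 0 < c by rewrite divr_gt0 ?ltr0n // ln_gt0 // ltr1n.
apply: (@lt_le_trans _ _ c%:E); first by rewrite lte_fin.
rewrite /entropy net_limsupE; apply: le_ereal_inf_tmp => _ [i _ <-].
(* Each tail supremum is bounded below by the term at its first index [i]. *)
apply: ereal_sup_ge; exists (ln #|` fset_set (patterns X (F i))|%:R / #|` F i|%:R)%:E.
  by exists i => //=.
have [S [SF Sfree Scard]] := greedy (F i).
have Fi0 : (0 < #|` F i|)%N by rewrite cardfs_gt0.
have P := free_at_card xyg SF Sfree.
rewrite lee_fin /c ler_pdivlMr ?ltr0n // mulrAC ler_pdivrMr ?ltr0n //.
apply: (@le_trans _ _ (ln 2 * #|` S|%:R * #|` D|.+1%:R)).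
  by rewrite -mulrA -natrM ler_wpM2l ?ler_nat // ln_ge0 // ler1n.
rewrite ler_wpM2r // mulr_natr -lnXn // -natrX ler_ln ?posrE ?ltr0n ?ler_nat //.
  by rewrite expn_gt0.
by apply: leq_trans P; rewrite expn_gt0.
Qed.
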